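(* Let $n$ be a natural number, let $(\mathcal A,\varphi,\gamma)$ be a $\mathbb Z_n$-graded algebraic noncommutative probability space, let $a$ be a homogeneous element of $\mathcal A$, and let $q$ be a primitive $n$-th root of unity. Set $n'=1$ if $a\in\mathcal A_1$, and $n'=n/\gcd(\delta_q(a),n)$ otherwise. Then the graded $R^{(n)}_q$-transform of $a$ satisfies $$R^{(n)}_q[a](z)=\log\left[\sum_{k\ge0}\frac{\mu_a(X^{kn'})}{k!}\,z^{kn'}\right]$$ as formal power series in $z$.
   Context: **Graded spaces.** A $\mathbb Z_n$-graded algebraic noncommutative probability space $(\mathcal A,\varphi,\gamma)$ consists of a unital complex algebra $\mathcal A$, a linear functional $\varphi$ on $\mathcal A$ with $\varphi(\mathbf 1)=1$, and a unital algebra automorphism $\gamma$ of $\mathcal A$ of order $n$ with $\varphi\circ\gamma=\varphi$. For an $n$-th root of unity $\omega$, put $\mathcal A_\omega=\{a\in\mathcal A:\gamma(a)=\omega a\}$; $\mathcal A$ is the direct sum of these eigenspaces. Elements of an eigenspace are called homogeneous. For a primitive $n$-th root of unity $q$ and $a\in\mathcal A_{q^r}$, the $q$-degree of $a$ is $\delta_q(a)=r$ (an integer modulo $n$). **Moments and $q$-cumulants.** For $a\in\mathcal A$, $\mu_a:\mathbb C[X]\to\mathbb C$ is the linear functional with $\mu_a(X^k)=\varphi(a^k)$, $k\ge0$. A crossing of a set partition $P$ of $[N]=\{1,\dots,N\}$ is a quadruple $a_1<b_1<a_2<b_2$ with $a_1,a_2\in A$ and $b_1,b_2\in B$ for distinct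 blocks $A,B$ of $P$; it is left reduced if $a_1=\min A$ and $b_1=\min B$. The restricted crossing number $c_0(P)$ is the number of left reduced crossings. For a complex number $q$ and a linear functional $\mu:\mathbb C[X]\to\mathbb C$ with $\mu(1)=1$, the $q$-cumulants $(\alpha^{(q)}_k)_{k\ge1}$ of $\mu$ are determined recursively by $$\mu(X^k)=\sum_{P}q^{c_0(P)}\prod_{B\text{ a block of }P}\alpha^{(q)}_{|B|}\qquad(k\ge1),$$ the sum being over all set partitions $P$ of $[k]$. **$R$-transforms.** If $m$ is a natural number, $\omega\ne1$ satisfies $\omega^m=1$, and $\mu$ satisfies $\mu(1)=1$ and $\mu(X^k)=0$ unless $m\mid k$, put $R^{(m)}_\omega[\mu](z)=\sum_{k\ge1}\frac{\alpha^{(\omega)}_{mk}}{k!}z^{mk}$. For arbitrary $\mu$ with $\mu(1)=1$ put $R_1[\mu](z)=\sum_{k\ge1}\frac{\alpha^{(1)}_k}{k!}z^k$. **Graded $R$-transform.** For $q$ a primitive $n$-th root of unity and $a\in\mathcal A$ homogeneous, $R^{(n)}_q[a](z)=R_1[\mu_a](z)$ if $a\in\mathcal A_1$; and if $a\in\mathcal A_{q^r}$ with $\mathcal A_{q^r}\neq\mathcal A_1$ (and $a\notin\mathcal A_1$), $R^{(n)}_q[a](z)=R^{(n')}_{q^r}[\mu_a](z)$ where $n'=n/\gcd(r,n)$. The logarithm is that of formal power series with constant term $1$. *)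

(* Defs.v *)
From HB Require Import structures.
From mathcomp Require Import all_boot all_order all_algebra.
From mathcomp Require Import reals complex.

Set Implicit Arguments.
Unset Strict Implicit.
Unset Printing Implicit Defensive.

Import GRing.Theory Num.Theory.
Local Open Scope ring_scope.

(* Everything is developed over a numFieldType C; the complex numbers are the
   instance C := R[i] with R : realType. *)

Section FormalPowerSeries.
Variable C : numFieldType.

(* The series sum_N (f N) z^N; [=1] is equality of formal power series. *)
Definition fps := nat -> C.

Definition fps_one : fps := fun N => (N == 0)%:R.
Definition fps_sub (f g : fps) : fps := fun N => f N - g N.
Definition fps_mul (f g : fps) : fps :=
  fun N => \sum_(i < N.+1) f i * g (N - i)%N.
Definition fps_exp (f : fps) (j : nat) : fps := iter j (fps_mul f) fps_one.

(* log f = sum_(j >= 1) (-1)^(j-1) / j (f - 1)^j for f with constant term 1.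
   By fps_exp_small the terms with j > N do not contribute to z^N. *)
Definition fps_log (f : fps) : fps := fun N =>
  \sum_(1 <= j < N.+1)
     (-1) ^+ j.-1 / j%:R * fps_exp (fps_sub f fps_one) j N.

Lemma fps_exp_small (f : fps) (j N : nat) :
  f 0%N = 0 -> (N < j)%N -> fps_exp f j N = 0.
Proof.
move=> f0; elim: j N => // j IHj N ltNj.
rewrite /fps_exp iterS /fps_mul big1 // => -[[|i] lt_i] _ /=.
  by rewrite f0 mul0r.
by rewrite -/(fps_exp f j) IHj ?mulr0 //; case: N ltNj lt_i => // N ltNj _;
   rewrite subSS (leq_ltn_trans (leq_subr _ _)).
Qed.

(* The series sum_(k >= 0) (c k) z^(m k), for m > 0. *)
Definition fps_in_powers (m : nat) (c : nat -> C) : fps :=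
  fun N => if (m %| N)%N then c (N %/ m)%N else 0.

End FormalPowerSeries.

Section Crossings.

(* Set partitions of [k] are the P : {set {set 'I_k}} with
   partition P [set: 'I_k]; the points are numbered from 0. *)

Definition crossing (k : nat) (P : {set {set 'I_k}})
    (A B : {set 'I_k}) (x : 'I_k * 'I_k * 'I_k * 'I_k) : bool :=
  let: (a1, b1, a2, b2) := x in
  [&& A \in P, B \in P, A != B,
      a1 \in A, a2 \in A, b1 \in B, b2 \in B
    & (a1 < b1 < a2)%N && (a2 < b2)%N].

Definition is_min (k : nat) (a : 'I_k) (A : {set 'I_k}) : bool :=
  (a \in A) && [forall i in A, (a <= i)%N].

Definition left_reduced_crossing (k : nat) (P : {set {set 'I_k}})
    (x : 'I_k * 'I_k * 'I_k * 'I_k) : bool :=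
  let: (a1, b1, _, _) := x in
  [exists A : {set 'I_k}, exists B : {set 'I_k},
     [&& crossing P A B x, is_min a1 A & is_min b1 B]].

Definition restricted_crossing_number (k : nat) (P : {set {set 'I_k}}) : nat :=
  #|[set x | left_reduced_crossing P x]|.

End Crossings.

Section Cumulants.
Variable C : numFieldType.

Definition partition_weight (q : C) (alpha : nat -> C) (k : nat)
    (P : {set {set 'I_k}}) : C :=
  q ^+ restricted_crossing_number P * \prod_(B in P) alpha #|B|.

Definition moment_cumulant (q : C) (mu : {scalar {poly C}})
    (alpha : nat -> C) : Prop :=
  forall k : nat, (0 < k)%N ->
    mu 'X^k = \sum_(P : {set {set 'I_k}} | partition P [set: 'I_k])
                partition_weight q alpha P.

(* The moment-cumulant formula solved for the contribution alpha_k of the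
   one-block partition.  The right-hand side at k only uses alpha_j for
   0 < j < k, so k iterations starting from anything determine alpha_k. *)
Definition q_cumulant_step (q : C) (mu : {scalar {poly C}})
    (alpha : nat -> C) : nat -> C := fun k =>
  mu 'X^k - \sum_(P : {set {set 'I_k}} |
                   partition P [set: 'I_k] && (P != [set [set: 'I_k]]))
              partition_weight q alpha P.

Definition q_cumulant (q : C) (mu : {scalar {poly C}}) (k : nat) : C :=
  iter k (q_cumulant_step q mu) (fun=> 0) k.

Lemma one_block_partition (k : nat) :
  (0 < k)%N -> partition [set [set: 'I_k]] [set: 'I_k].
Proof.
move=> k_gt0; apply/and3P; split.
- by rewrite /cover big_set1.
- by apply/trivIsetP=> A B /set1P-> /set1P->; rewrite eqxx.
- rewrite inE eq_sym; apply/eqP=> /setP/(_ (Ordinal k_gt0)).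
  by rewrite !inE.
Qed.

Lemma one_block_weight (q : C) (alpha : nat -> C) (k : nat) :
  partition_weight q alpha [set [set: 'I_k]] = alpha k.
Proof.
rewrite /partition_weight big_set1 cardsT card_ord.
suff -> : restricted_crossing_number [set [set: 'I_k]] = 0%N.
  by rewrite expr0 mul1r.
apply/eqP; rewrite cards_eq0; apply/eqP/setP=> -[[[a1 b1] a2] b2].
rewrite !inE; apply/negbTE/existsP=> -[A /existsP[B /and3P[/and3P[]]]].
by move=> /set1P-> /set1P->; rewrite eqxx.
Qed.

Lemma moment_cumulant_stepE (q : C) (mu : {scalar {poly C}})
    (alpha : nat -> C) :
  moment_cumulant q mu alpha <->
  (forall k : nat, (0 < k)%N -> alpha k = q_cumulant_step q mu alpha k).
Proof.
split=> h k k_gt0; have := h k k_gt0.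
  rewrite (bigD1 [set [set: 'I_k]] (one_block_partition k_gt0)) one_block_weight /=.
  by rewrite /q_cumulant_step => ->; rewrite addrK.
rewrite (bigD1 [set [set: 'I_k]] (one_block_partition k_gt0)) one_block_weight /=.
by rewrite {1}/q_cumulant_step => ->; rewrite subrK.
Qed.

Lemma q_cumulant_step_local (q : C) (mu : {scalar {poly C}})
    (alpha beta : nat -> C) (k : nat) :
  (forall j : nat, (0 < j < k)%N -> alpha j = beta j) ->
  q_cumulant_step q mu alpha k = q_cumulant_step q mu beta k.
Proof.
move=> eq_ab; congr (_ - _); apply: eq_bigr => P /andP[partP neP].
congr (_ * _); apply: eq_bigr => B BP; apply: eq_ab.
have /and3P[/eqP covP tiP P0] := partP.
have B0 : B != set0 by apply: contraNneq P0 => <-.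
rewrite card_gt0 B0 /= ltn_neqAle.
have := max_card B; rewrite card_ord => ->; rewrite andbT.
apply: contraNneq neP => cardB.
have defB : B = [set: 'I_k].
  by apply/eqP; rewrite eqEcard subsetT cardsT card_ord cardB leqnn.
rewrite eqEsubset sub1set -defB BP andbT; apply/subsetP=> A AP.
rewrite inE; apply: contraT => neAB; have := trivIsetP tiP A B AP BP neAB.
rewrite -setI_eq0 defB setIT => /eqP A0.
by rewrite A0 (negPf P0) in AP.
Qed.

Lemma moment_cumulant_q_cumulant (q : C) (mu : {scalar {poly C}}) :
  moment_cumulant q mu (q_cumulant q mu).
Proof.
pose u n := iter n (q_cumulant_step q mu) (fun=> 0).
have u_stable n j : (0 < j <= n)%N -> u n j = u j j.
  have [m] := ubnP n; elim: m n j => // m IH [|n] j ltnm /andP[j_gt0 le_jn].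
    by case: j j_gt0 le_jn.
  case: j j_gt0 le_jn => // j _ le_jn; rewrite /u !iterS -!/(u _).
  apply: q_cumulant_step_local => i /andP[i_gt0 lt_ij].
  by rewrite (IH n) ?(IH j) // ?i_gt0 //; [exact: leq_trans le_jn ltnm
     | exact: leq_trans lt_ij le_jn].
apply/moment_cumulant_stepE => -[|k] // _.
rewrite {1}/q_cumulant iterS -/(u k).
apply: q_cumulant_step_local => j /andP[j_gt0 lt_jk].
by rewrite u_stable // j_gt0.
Qed.

Lemma moment_cumulant_unique (q : C) (mu : {scalar {poly C}})
    (alpha beta : nat -> C) :
  moment_cumulant q mu alpha -> moment_cumulant q mu beta ->
  forall k : nat, (0 < k)%N -> alpha k = beta k.
Proof.
move=> /moment_cumulant_stepE ha /moment_cumulant_stepE hb k.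
have [m] := ubnP k; elim: m k => // m IH k lt_km k_gt0.
rewrite ha // hb //; apply: q_cumulant_step_local => j /andP[j_gt0 lt_jk].
by apply: IH => //; apply: leq_trans lt_jk _.
Qed.

(* Only meaningful for omega != 1, omega ^+ m = 1, mu 1 = 1 and mu 'X^k = 0
   unless m divides k. *)
Definition R_omega (m : nat) (omega : C) (mu : {scalar {poly C}}) : fps C :=
  fps_in_powers m
    (fun k => if k == 0%N then 0 else q_cumulant omega mu (m * k) / k`!%:R).

Definition R_one (mu : {scalar {poly C}}) : fps C :=
  fun k => if k == 0%N then 0 else q_cumulant 1 mu k / k`!%:R.

End Cumulants.

Record graded_ncps (C : numFieldType) (n : nat) := GradedNCPS {
  ncps_alg :> algType C;
  ncps_phi : {scalar ncps_alg};
  ncps_gamma : {lrmorphism ncps_alg -> ncps_alg};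
  ncps_phi1 : ncps_phi 1 = 1;
  ncps_gamma_bij : bijective ncps_gamma;
  ncps_order_gt0 : (0 < n)%N;
  ncps_gamma_order : iter n ncps_gamma =1 id;
  ncps_gamma_order_min :
    forall k : nat, (0 < k < n)%N -> ~ (iter k ncps_gamma =1 id);
  ncps_phi_gamma : forall a : ncps_alg, ncps_phi (ncps_gamma a) = ncps_phi a
}.

Arguments ncps_phi {C n} A : rename.
Arguments ncps_gamma {C n} A : rename.

Section GradedSpaces.
Variables (C : numFieldType) (n : nat) (A : graded_ncps C n).

Definition eigenspace_of (omega : C) : {pred A} :=
  [pred a | ncps_gamma A a == omega *: a].

Definition homogeneous (a : A) : Prop :=
  exists2 omega : C, n.-unity_root omega & a \in eigenspace_of omega.

(* mu_a p = phi (p (a)) *)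
Definition moment_functional (a : A) (p : {poly C}) : C :=
  ncps_phi A (horner_alg a p).

Lemma moment_functional_is_scalar (a : A) : scalar (moment_functional a).
Proof.
move=> c p r; rewrite /moment_functional rmorphD -mul_polyC rmorphM /=.
by rewrite horner_algC -scalerAl mul1r linearD scalarZ.
Qed.

HB.instance Definition _ (a : A) :=
  GRing.isLinear.Build C {poly C} C _ (moment_functional a)
    (moment_functional_is_scalar a).

Lemma moment_functionalXn (a : A) (k : nat) :
  moment_functional a 'X^k = ncps_phi A (a ^+ k).
Proof. by rewrite /moment_functional rmorphXn /= horner_algX. Qed.

(* The representative in {0, ..., n-1} of the q-degree of a homogeneous a.
   It is uniquely determined unless a = 0 (see q_degree_unique). *)
Definition q_degree (q : C) (a : A) : nat :=
  if [pick r : 'I_n | a \in eigenspace_of (q ^+ r)] is Some r then r else 0%N.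

Lemma q_degreeP (q : C) (a : A) : n.-primitive_root q -> homogeneous a ->
  a \in eigenspace_of (q ^+ q_degree q a).
Proof.
move=> q_prim [omega /unity_rootP omegaX aP]; rewrite /q_degree.
case: pickP => // noP; have [i Ei] := prim_rootP q_prim omegaX.
by have := noP i; rewrite /= -Ei aP.
Qed.

Lemma q_degree_unique (q : C) (a : A) (r : nat) : n.-primitive_root q ->
  a != 0 -> a \in eigenspace_of (q ^+ r) -> q_degree q a = (r %% n)%N.
Proof.
move=> q_prim a0 aP; have n_gt0 := prim_order_gt0 q_prim.
have aP' : a \in eigenspace_of (q ^+ q_degree q a).
  by apply: q_degreeP => //; exists (q ^+ r) => //;
     apply/unity_rootP; rewrite -exprM mulnC exprM (prim_expr_order q_prim) expr1n.
have : (q ^+ q_degree q a - q ^+ r) *: a == 0.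
  by move: aP aP'; rewrite !inE scalerBl subr_eq0 => /eqP <- /eqP <-.
rewrite scaler_eq0 (negPf a0) orbF subr_eq0 (eq_prim_root_expr q_prim).
suff lt_dn : (q_degree q a < n)%N by rewrite (modn_small lt_dn) => /eqP.
by rewrite /q_degree; case: pickP => [[]|].
Qed.

(* If a is not in the fixed algebra of gamma, then its eigenspace is
   automatically different from that algebra. *)
Definition graded_R (q : C) (a : A) : fps C :=
  if a \in eigenspace_of 1 then R_one (moment_functional a)
  else R_omega (n %/ gcdn (q_degree q a) n) (q ^+ q_degree q a)
               (moment_functional a).

End GradedSpaces.

Arguments eigenspace_of {C n} A omega.

(* Main.v *)
Require Import Defs.
From mathcomp Require Import all_boot all_order all_algebra.
From mathcomp Require Import reals complex.
From mathcomp Require Import zify ring.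
Import GRing.Theory Num.Theory.
Local Open Scope ring_scope.
Local Open Scope complex_scope.
Set Implicit Arguments.
Unset Strict Implicit.
Unset Printing Implicit Defensive.

(* Let q be a primitive m-th root of unity, m = n'.  Removing the block with the
   largest minimum from a set partition, the restricted crossings with that block
   contribute a Gaussian binomial coefficient, so the moments are given by a
   recursion whose only q-dependence is through these coefficients.  Moments, hence
   cumulants, vanish in degrees not divisible by m, and then by the q-analogue of
   Lucas' theorem only steps compatible with the multiples of m survive, with
   ordinary binomial coefficients: mu(X^(mk)) and alpha_(mk) satisfy the classical
   (q = 1) moment-cumulant relation.  Removing there the block of a fixed point
   gives F' = F * L' for the exponential generating series F of the moments and L
   of the cumulants, whence L = log F. *)

(** * Sums over subsets and set partitions, split at a chosen point *)

Section Subsets.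
Variables (T : finType) (V : nmodType).
Implicit Types (S B : {set T}) (P : {set {set T}}).

Lemma sum_subset_mem S x (F : {set T} -> V) : x \in S ->
  \sum_(B : {set T} | (B \subset S) && (x \in B)) F B
  = \sum_(B : {set T} | B \subset S :\ x) F (x |: B).
Proof.
move=> xS; rewrite (reindex_onto (fun B => x |: B) (fun B => B :\ x)) /=; last first.
  by move=> B /andP[_ xB]; rewrite setD1K.
apply: eq_bigl => B; rewrite setU11 andbT subsetD1 subUset sub1set xS /=.
case BS: (B \subset S) => //=; apply/eqP/idP => [<-|xB]; last by rewrite setU1K.
by rewrite !inE eqxx.
Qed.

(** Partitions are sorted by the block containing [x]; deleting that block is a bijection onto the
    partitions of the rest. *)
Lemma sum_partition_block S x (F : {set {set T}} -> V) : x \in S ->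
  \sum_(P | partition P S) F P
  = \sum_(B : {set T} | (B \subset S) && (x \in B))
      \sum_(P | partition P (S :\: B)) F (B |: P).
Proof.
move=> xS; rewrite (partition_big (fun P => pblock P x)
    (fun B : {set T} => (B \subset S) && (x \in B))) /=; last first.
  move=> P partP; rewrite mem_pblock (cover_partition partP) xS andbT.
  by rewrite (partitionS partP) // pblock_mem // (cover_partition partP).
apply: eq_bigr => B /andP[BS xB].
rewrite (reindex_onto (fun P => B |: P) (fun P => P :\ B)) /=; last first.
  move=> P /andP[partP /eqP <-]; rewrite setD1K // pblock_mem //.
  by rewrite (cover_partition partP).
have B0 : B != set0 by apply/set0Pn; exists x.
apply: eq_bigl => P; apply/idP/idP => [/andP[/andP[partP _] /eqP defP]|partP].
  by rewrite -defP partitionD1 // setU11.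
have BP : B \notin P.
  apply: contraL xB => /(partitionS partP)/subsetP/(_ x).
  by rewrite !inE => h; apply/negP => xB; move: (h xB); rewrite xB.
have partU : partition (B |: P) S.
  have := partitionU1 partP B0; rewrite -setI_eq0 setIDA setIC -setIDA setDv setI0.
  rewrite eqxx => /(_ isT); suff -> : B :|: S :\: B = S by [].
  by apply/setP => y; rewrite !inE; have := subsetP BS y; case: (y \in B) => // ->.
rewrite partU setU1K // eqxx andbT (def_pblock _ _ xB) ?eqxx ?setU11 //.
by have /and3P[] := partU.
Qed.

End Subsets.

(** Serves for sums with a factor [alpha i.+1], where [alpha] is supported on multiples of [m]: only
    [i] congruent to -1 modulo [m] survives. *)
Lemma sum_last_residue (V : nmodType) (m k : nat) (f : nat -> V) :
  (0 < m)%N -> (forall i, ~~ (m %| i.+1)%N -> f i = 0) ->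
  \sum_(i < m * k) f i = \sum_(c < k) f (m * c + m.-1)%N.
Proof.
move=> m0 f0; elim: k => [|k IH]; first by rewrite muln0 !big_ord0.
rewrite big_ord_recr /= -IH mulnS addnC big_split_ord /=; congr (_ + _).
case: m m0 f0 {IH} => // m _ f0; rewrite big_ord_recr /= big1 ?add0r // => i _.
apply: f0; rewrite -addnS dvdn_addr ?dvdn_mulr //.
by rewrite gtnNdvd // ltnS ltn_ord.
Qed.

(** * Gaussian binomial coefficients and the q-Lucas theorem *)

Section GaussBinomial.
Variable R : fieldType.

(** Gaussian binomial coefficients, by the Pascal rule that matches the count by inversions in
    [sum_subset_inversions]. *)
Fixpoint qbinomial (q : R) (n k : nat) {struct n} : R :=
  match n, k with
  | _, 0 => 1
  | 0, _.+1 => 0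
  | n'.+1, k'.+1 => qbinomial q n' k' + q ^+ k * qbinomial q n' k
  end.

Lemma qbinomial0 q n : qbinomial q n 0 = 1.
Proof. by case: n. Qed.

Lemma qbinomialS q n k : qbinomial q n.+1 k.+1
  = qbinomial q n k + q ^+ k.+1 * qbinomial q n k.+1.
Proof. by []. Qed.

Lemma qbinomial_small q n k : (n < k)%N -> qbinomial q n k = 0.
Proof.
elim: n k => [|n IH] [|k] // ltnk.
by rewrite qbinomialS !IH ?mulr0 ?addr0 // ltnW.
Qed.

Lemma qbinomialnn q n : qbinomial q n n = 1.
Proof. by elim: n => // n IH; rewrite qbinomialS IH qbinomial_small ?mulr0 ?addr0. Qed.

Lemma qbinomial_bin n k : qbinomial 1 n k = 'C(n, k)%:R.
Proof.
elim: n k => [|n IH] [|k] //.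
by rewrite qbinomialS !IH expr1n mul1r binS natrD addrC.
Qed.

(** The q-analogue of (k+1) C(n+1, k+1) = (n+1) C(n, k), free of division so that it applies at
    roots of unity. *)
Lemma qbinomial_absorb q n k :
  (1 - q ^+ k.+1) * qbinomial q n.+1 k.+1 = (1 - q ^+ n.+1) * qbinomial q n k.
Proof.
elim: n k => [|n IH] [|k].
- by rewrite qbinomialS /= mulr0 addr0.
- by rewrite qbinomialS /= !mulr0 addr0 mulr0.
- rewrite qbinomialS mulrDr mulrCA IH !qbinomial0 (exprS q n.+1); ring.
- rewrite qbinomialS mulrDr mulrCA IH.
  have := IH k; rewrite qbinomialS.
  move: (qbinomial q n k) (qbinomial q n k.+1) => x y e.
  rewrite (exprS q k.+1) (exprS q n.+1).
  move: (q ^+ k.+1) (q ^+ n.+1) e => u v e.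
  apply/eqP; rewrite -subr_eq0.
  have -> : (1 - q * u) * (x + u * y) + q * u * ((1 - v) * y)
      - (1 - q * v) * (x + u * y)
    = q * ((1 - u) * (x + u * y) - (1 - v) * x) by ring.
  by rewrite e subrr mulr0.
Qed.


(** In the absorption identity the right side vanishes as [q ^+ m = 1], while the left factor is
    nonzero because [q] has exact order [m]. *)
Lemma qbinomial_prim_root q m s : m.-primitive_root q ->
  (0 < s < m)%N -> qbinomial q m s = 0.
Proof.
move=> qm /andP[]; case: s => // s _; case: m qm => // m qm lt_sm.
have := qbinomial_absorb q m s; rewrite (prim_expr_order qm) subrr mul0r.
move/eqP; rewrite mulf_eq0 subr_eq0 eq_sym -(prim_order_dvd qm).
by rewrite gtnNdvd //= => /eqP.
Qed.

(** Induction along the Pascal rule, whose power of [q] only sees [s]. A borrow occurs when [r] or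
    [s] is 0; when both are, it becomes the ordinary Pascal rule for [l] and [c]. *)
Lemma qbinomial_lucas q m l r c s : m.-primitive_root q ->
  (r < m)%N -> (s < m)%N ->
  qbinomial q (m * l + r) (m * c + s) = 'C(l, c)%:R * qbinomial q r s.
Proof.
move=> qm; have m0 := prim_order_gt0 qm.
have [n] := ubnP (m * l + r); elim: n l r c s => // n IH l r c s.
rewrite ltnS => le_n lt_rm lt_sm.
have qmc k : q ^+ (m * c + k) = q ^+ k.
  by rewrite exprD exprM (prim_expr_order qm) expr1n mul1r.
have [ks|[k Ek]] : (m * c + s = 0)%N \/ exists k, (m * c + s = k.+1)%N.
- by case: (m * c + s)%N => [|k]; [left | right; exists k].
- have /eqP := ks; rewrite addn_eq0 muln_eq0 (gtn_eqF m0) /= => /andP[/eqP-> /eqP->].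
  by rewrite muln0 !qbinomial0 bin0 mulr1.
case: r le_n lt_rm => [|r] le_n lt_rm.
  case: l le_n => [|l] le_n.
    rewrite muln0 addn0 Ek; case: c {qmc} Ek => [|c] Ek.
      by move: Ek; rewrite muln0 add0n => ->; rewrite bin0 mul1r.
    by rewrite bin0n mul0r.
  have El : (m * l.+1 + 0 = (m * l + m.-1).+1)%N by rewrite mulnS; lia.
  rewrite El Ek qbinomialS -Ek qmc.
  rewrite (IH l m.-1 c s) // ?prednK //; last by lia.
  case: s lt_sm Ek => [|s] lt_sm Ek.
    case: c {qmc} Ek => [|c] Ek; first by lia.
    have -> : k = (m * c + m.-1)%N by move: Ek; rewrite mulnS; lia.
    rewrite (IH l m.-1 c m.-1) // ?prednK //; last by lia.
    by rewrite qbinomialnn !qbinomial0 !mulr1 expr0 mul1r binS natrD addrC.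
  have -> : k = (m * c + s)%N by lia.
  rewrite (IH l m.-1 c s) //; [|lia|lia|lia].
  (* The two terms reassemble [m choose s+1], which vanishes at a primitive m-th root of unity. *)
  rewrite mulrCA -mulrDr -qbinomialS prednK // qbinomial_prim_root //.
  by rewrite mulr0 (@qbinomial_small _ 0) // mulr0.
rewrite addnS Ek qbinomialS -Ek qmc.
rewrite (IH l r c s) //; [|lia|lia].
case: s lt_sm Ek => [|s] lt_sm Ek.
  case: c {qmc} Ek => [|c] Ek; first by lia.
  have -> : k = (m * c + m.-1)%N by move: Ek; rewrite mulnS; lia.
  rewrite (IH l r c m.-1) //; [|lia|lia|lia].
  (* The borrowed term is [r choose m-1] with r < m-1. *)
  by rewrite qbinomial_small ?mulr0 ?add0r ?expr0 ?mul1r ?qbinomial0 //; lia.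
have -> : k = (m * c + s)%N by lia.
rewrite (IH l r c s) //; [|lia|lia|lia].
by rewrite mulrCA -mulrDr -qbinomialS.
Qed.

End GaussBinomial.

(** * Formal logarithms through logarithmic derivatives *)

Section LogarithmicDerivative.
Variable C : numFieldType.
Implicit Types (f g : fps C).

(** Low coefficients only see the truncation, so polynomial algebra and derivatives can replace
    power series. *)
Lemma fps_exp_coef f j K N : (N <= K)%N ->
  fps_exp f j N = ((\poly_(i < K.+1) f i) ^+ j)`_N.
Proof.
elim: j N => [|j IH] N leNK; first by rewrite expr0 coef1.
rewrite /fps_exp iterS -/(fps_exp f j) exprS coefM; apply: eq_bigr => -[i /= lt_iN] _.
by rewrite IH ?(leq_trans (leq_subr _ _)) // coef_poly (leq_trans lt_iN).
Qed.

Lemma coef_exp_small (p : {poly C}) (j N : nat) :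
  p`_0 = 0 -> (N < j)%N -> (p ^+ j)`_N = 0.
Proof.
move=> p0 ltNj; have : root p 0 by rewrite /root horner_coef0 p0.
by case/factor_theorem => r ->; rewrite subr0 exprMn coefMXn ltNj.
Qed.

(* The hypothesis is [f' = f * g'], coefficientwise. *)
Lemma fps_log_unique f g : f 0%N = 1 -> g 0%N = 0 ->
  (forall N, N.+1%:R * f N.+1
     = \sum_(i < N.+1) i.+1%:R * g i.+1 * f (N - i)%N) ->
  g =1 fps_log f.
Proof.
move=> f0 g0 fg N.
case: N => [|K]; first by rewrite g0 /fps_log big_geq.
set K1 := K.+1.
pose u := fps_sub f (@fps_one C).
pose U : {poly C} := \poly_(i < K1.+1) u i.
pose L : {poly C} := \sum_(1 <= j < K1.+1) ((-1) ^+ j.-1 / j%:R) *: U ^+ j.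
pose G : {poly C} := \poly_(i < K1.+1) g i.
have U0 : U`_0 = 0 by rewrite coef_poly /u /fps_sub f0 subrr.
have -> : fps_log f K1 = L`_K1.
  rewrite /L coef_sum; apply: eq_bigr => j _.
  by rewrite coefZ -(fps_exp_coef u j (leqnn _)).
(* By a geometric sum, the truncated logarithm [L] satisfies (1 + U) L' = U' up to terms of order
   [K1]. *)
have dL : (1 + U) * L^`() = U^`() * (1 - (- U) ^+ K1).
  have -> : L^`() = U^`() * \sum_(i < K1) (- U) ^+ i.
    rewrite /L raddf_sum big_add1 /= big_mkord mulr_sumr; apply: eq_bigr => i _.
    rewrite derivZ deriv_exp -scaler_nat scalerA divfK ?pnatr_eq0 //=.
    by rewrite scalerAr -mul_polyC rmorphXn rmorphN1 -exprNn.
  have -> : 1 - (- U) ^+ K1 = (1 + U) * \sum_(i < K1) (- U) ^+ i.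
    by rewrite -[LHS]opprB subrX1 -mulNr opprB opprK.
  by rewrite mulrCA.
have dG i : (i < K1)%N -> ((1 + U) * G^`())`_i = (U^`())`_i.
  move=> lt_i; rewrite coef_deriv coef_poly ltnS lt_i /u /fps_sub subr0.
  rewrite -mulr_natl fg mulrC coefM; apply: eq_bigr => -[j /= lt_j] _.
  have lt_jK : (j < K1)%N by apply: leq_trans lt_j _.
  rewrite coef_deriv coef_poly ltnS lt_jK -[g _ *+ _]mulr_natl; congr (_ * _).
  rewrite coefD coef1 coef_poly ltnS (leq_trans (leq_subr _ _)) ?(ltnW lt_i) //.
  by rewrite /u /fps_sub /fps_one addrC subrK.
have dLG i : (i < K1)%N -> ((L - G)^`())`_i = 0.
  have : forall i, (i < K1)%N -> ((1 + U) * (L - G)^`())`_i = 0.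
    move=> {}i lt_i; rewrite derivB mulrBr coefB dG // dL mulrBr mulr1 coefB.
    rewrite coefM big1 ?subr0 ?subrr // => -[j /= lt_j] _.
    rewrite coef_exp_small ?mulr0 ?coefN ?U0 ?oppr0 //.
    exact: leq_ltn_trans (leq_subr _ _) lt_i.
  (* Since [1 + U] has constant term 1, multiplication by it is inverted degree by degree. *)
  move: (_^`()) => P h; have [n] := ubnP i; elim: n i => // n IH i ltin lt_iK.
  have := h i lt_iK; rewrite coefM big_ord_recl big1 ?addr0 => [|[j /= lt_j] _].
    by rewrite subn0 coefD coef1 U0 addr0 mul1r.
    rewrite IH ?mulr0 //= /bump /=; lia.
have := dLG K (ltnSn _); rewrite coef_deriv => /eqP.
rewrite -mulr_natr mulf_eq0 pnatr_eq0 orbF coefB subr_eq0 => /eqP ->.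
by rewrite coef_poly ltnS leqnn.
Qed.
End LogarithmicDerivative.

(** * The recursion for weighted partition counts at a root of unity *)

Section MomentRecursion.
Variable C : numFieldType.
Implicit Types (q : C) (alpha : nat -> C).

(* The weighted sum over the partitions of u + v points all of whose blocks meet
   the first u points (see [partition_sumE]).  In the successor case either every
   block meets the first u' points, or the last block consists of the point u'
   and of b of the v points after it. *)
Fixpoint partition_count q alpha (u v : nat) {struct u} : C :=
  if u is u'.+1 then
    partition_count q alpha u' v.+1
    + \sum_(b < v.+1) qbinomial q v b * alpha b.+1 * partition_count q alpha u' (v - b)
  else (v == 0%N)%:R.

Lemma partition_countS q alpha u v :
  partition_count q alpha u.+1 v = partition_count q alpha u v.+1
    + \sum_(b < v.+1) qbinomial q v b * alpha b.+1 * partition_count q alpha u (v - b).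
Proof. by []. Qed.

(** A group of [m] points acts as one point at [q = 1]: a new block has size divisible by [m], and
    by q-Lucas its coefficient can be nonzero only if the number of points to the right is -1 modulo
    [m], which happens once per group. *)
Lemma partition_count_root q alpha m u v : m.-primitive_root q ->
  (forall k, (0 < k)%N -> ~~ (m %| k)%N -> alpha k = 0) ->
  partition_count q alpha (m * u) (m * v)
  = partition_count 1 (fun k => alpha (m * k)%N) u v.
Proof.
move=> qm alpha0; have m0 := prim_order_gt0 qm.
elim: u v => [|u IH] v.
  by rewrite muln0 /= muln_eq0 (gtn_eqF m0).
(* These [r] points open no block: each coefficient contains some [r' choose m-1] with r' < m-1. *)
have shift w r : (r < m)%N ->
    partition_count q alpha (w + r) (m * v) = partition_count q alpha w (m * v + r).
  elim: r w => [|r IHr] w lt_rm; first by rewrite !addn0.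
  rewrite -addSnnS IHr ?(ltnW lt_rm) // partition_countS addnS big1 ?addr0 // => -[b lt_b] _ /=.
  have [mb|mb] := boolP (m %| b.+1)%N; last by rewrite alpha0 // mulr0 mul0r.
  have -> : b = (m * (b %/ m) + m.-1)%N.
    case/dvdnP: mb => -[|c] Eb; first by lia.
    have -> : b = (c * m + m.-1)%N by lia.
    by rewrite divnMDl // divn_small ?prednK // addn0 mulnC.
  rewrite qbinomial_lucas ?prednK //; last by lia.
  by rewrite (@qbinomial_small _ q r m.-1) ?mulr0 ?mul0r //; lia.
(* The remaining point of the group sees [m * v + m.-1] points to its right; there [m-1 choose m-1]
   = 1 leaves an ordinary binomial. *)
rewrite mulnS addnC -(prednK m0) addnS -addSn prednK // shift ?prednK //.
rewrite !partition_countS.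
have Ev : (m * v + m.-1).+1 = (m * v.+1)%N by rewrite mulnS; lia.
rewrite Ev IH; congr (_ + _).
rewrite (@sum_last_residue _ m v.+1 (fun b => qbinomial q (m * v + m.-1) b * alpha b.+1
   * partition_count q alpha (m * u) (m * v + m.-1 - b))) //; last first.
  by move=> b mb; rewrite alpha0 // mulr0 mul0r.
apply: eq_bigr => -[c /= lt_c] _.
rewrite qbinomial_lucas ?prednK // qbinomialnn mulr1 qbinomial_bin.
by rewrite subnDr -mulnBr IH -addnS prednK // -mulnSr.
Qed.
End MomentRecursion.

(** * Inversions and restricted crossings *)

Section Crossings.
Variables (K : nat).
Implicit Types (S B T : {set 'I_K}) (P : {set {set 'I_K}}).

(** In [restricted_crossing_numberU1] these are the pairs (a2, b2) of the crossings whose second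
    block is [x |: B]. *)
Definition inversions B T : {set 'I_K * 'I_K} :=
  [set y | [&& y.1 \in T :\: B, y.2 \in B & (y.1 < y.2)%N]].

(** Induction on the least point [t] of [T]: inside [B] it takes part in no inversion, outside it
    precedes all of [B] and adds [#|B|] of them. This is the Pascal rule of [qbinomial]; the general
    [f] absorbs the shifts. *)
Lemma sum_subset_inversions (F : fieldType) (q : F) (f : nat -> F) T :
  \sum_(B : {set 'I_K} | B \subset T) q ^+ #|inversions B T| * f #|B|
  = \sum_(b < #|T|.+1) qbinomial q #|T| b * f b.
Proof.
have [n] := ubnP #|T|; elim: n T f => // n IH T f ltTn.
have [->|/set0Pn[t0 t0T]] := eqVneq T set0.
  rewrite cards0 big_ord1 (big_pred1 set0) => [|B]; last by rewrite subset0.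
  rewrite cards0; suff -> : inversions set0 set0 = set0 by rewrite cards0.
  by apply/setP => y; rewrite !inE.
have [t tT tmin] : exists2 t, t \in T & forall i, i \in T -> (t <= i)%N.
  by case: (arg_minnP (fun i : 'I_K => i : nat) t0T) => t tT tmin; exists t.
have cT : #|T| = #|T :\ t|.+1 by rewrite (cardsD1 t) tT.
have cU B : B \subset T :\ t -> #|t |: B| = #|B|.+1.
  by rewrite subsetD1 => /andP[_ tB]; rewrite cardsU1 tB.
have invU B : B \subset T :\ t -> inversions (t |: B) T = inversions B (T :\ t).
  move=> BT; apply/setP => -[a b]; rewrite !inE /=.
  have [->|nbt] //= := eqVneq b t; last by rewrite negb_or; case: (a == t); rewrite ?andbF.
  have -> : (t \in B) = false by apply: contraTF BT => tB; rewrite subsetD1 tB andbF.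
  apply/idP/idP => [/andP[/andP[_ aT]]|/and3P[] //].
  by move=> lt_at; rewrite ltnNge tmin in lt_at.
have invN B : B \subset T :\ t -> #|inversions B T| = (#|B| + #|inversions B (T :\ t)|)%N.
  rewrite subsetD1 => /andP[BT tB].
  have -> : inversions B T = (pair t @: B) :|: inversions B (T :\ t).
    apply/setP => -[a b]; rewrite !inE /=.
    have [->|nat] := eqVneq a t.
      rewrite tB tT /=; apply/idP/orP => [/andP[bB _]|[]].
      - by left; apply/imsetP; exists b.
      - case/imsetP => b' bB [->]; rewrite bB ltn_neqAle (tmin _ (subsetP BT _ bB)) andbT.
        by apply: contraNneq tB => /val_inj->.
      - by [].
    suff -> : ((a, b) \in pair t @: B) = false by [].
    by apply/imsetP => -[b' _ [/eqP]]; rewrite (negPf nat).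
  rewrite cardsU card_imset; last by move=> x y [].
  suff -> : (pair t @: B) :&: inversions B (T :\ t) = set0 by rewrite cards0 subn0.
  apply/setP => -[a b]; rewrite !inE; apply/negP => /andP[/imsetP[b' _ [-> _]]].
  by rewrite eqxx !andbF.
rewrite (bigID (fun B => t \in B)) /= sum_subset_mem //=.
under eq_bigr => B BT do rewrite invU // cU //.
rewrite (IH _ (fun k => f k.+1)); last by rewrite -ltnS -cT.
under [X in _ + X]eq_bigl => B do rewrite -subsetD1.
under [X in _ + X]eq_bigr => B BT do rewrite invN // exprD -mulrA mulrCA.
rewrite (IH _ (fun k => q ^+ k * f k)); last by rewrite -ltnS -cT.
rewrite cT; move: #|_| => k.
rewrite [X in _ + X]big_ord_recl [RHS]big_ord_recl /= !qbinomial0 expr0 !mul1r addrCA.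
congr (_ + _).
under [RHS]eq_bigr => i _ do rewrite mulrDl.
rewrite [RHS]big_split /=; congr (_ + _).
rewrite [RHS]big_ord_recr /= qbinomial_small // mulr0 mul0r addr0.
by apply: eq_bigr => i _; rewrite /= mulrCA mulrA.
Qed.


Lemma is_min_unique (a b : 'I_K) B : is_min a B -> is_min b B -> a = b.
Proof.
move=> /andP[aB /forall_inP mina] /andP[bB /forall_inP minb].
by apply/val_inj/eqP; rewrite eqn_leq mina // minb.
Qed.

Lemma exists_is_min (i : 'I_K) B : i \in B -> exists a, is_min a B.
Proof.
move=> iB; case: (arg_minnP (fun i : 'I_K => i : nat) iB) => a aB mina.
by exists a; apply/andP; split=> //; apply/forall_inP.
Qed.

(** Bounds all block minima of a partition by [j] without having to name them. *)
Definition mins_below P (j : nat) : bool :=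
  [forall B in P, [exists i in B, (i < j)%N]].

Lemma mins_below_min P j a B : mins_below P j -> B \in P -> is_min a B -> (a < j)%N.
Proof.
move=> /forall_inP mb /mb /exists_inP[i iB lt_ij] /andP[_ /forall_inP mina].
by apply: leq_ltn_trans lt_ij; apply: mina.
Qed.

Lemma mins_belowS P S (x : 'I_K) : partition P S -> x \notin S ->
  mins_below P x.+1 = mins_below P x.
Proof.
move=> partP xS; apply: eq_forallb_in => B BP; apply: eq_existsb_in => i iB.
rewrite ltnS leq_eqVlt; suff /negPf-> : i != x :> nat by [].
by apply: contraNneq xS => /val_inj <-; apply: subsetP (partitionS partP BP) _ iB.
Qed.

(* The block [x |: B] has the largest minimum, so it can only be the second
   block of a left reduced crossing, and any point a2 > x outside it lies in a
   block starting before x: the crossings with it depend on B and S only. *)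
Lemma restricted_crossing_numberU1 (x : 'I_K) S B P :
  x \in S -> B \subset [set i in S | (x < i)%N] ->
  partition P (S :\: (x |: B)) -> mins_below P x ->
  restricted_crossing_number ((x |: B) |: P)
  = (restricted_crossing_number P + #|inversions B [set i in S | (x < i)%N]|)%N.
Proof.
move=> xS BS partP mbP; set Q := _ |: P.
have inB i : i \in B -> (i \in S) /\ (x < i)%N by move=> /(subsetP BS); rewrite inE => /andP.
have minx : is_min x (x |: B).
  rewrite /is_min setU11; apply/forall_inP => i; rewrite !inE => /predU1P[->//|/inB[_ /ltnW //]].
have xP D : D \in P -> x \notin D.
  by move=> /(partitionS partP); apply: contraTN => xD; apply/subsetPn; exists x => //; rewrite !inE eqxx.
have tiP := partition_trivIset partP.
rewrite /restricted_crossing_number.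
(* Crossings are split by whether [b1] is [x]; those with another [b1] are exactly the crossings of
   [P]. *)
rewrite -(cardsID [set y : 'I_K * 'I_K * 'I_K * 'I_K | y.1.1.2 == x]) addnC; congr (_ + _)%N.
  apply: eq_card => -[[[a1 b1] a2] b2]; rewrite !inE /=.
  apply/andP/existsP => [[b1x /existsP[D /existsP[E /and3P[DE minD minE]]]]|[D /existsP[E /and3P[DE minD minE]]]].
    case/and5P: DE => DQ EQ neDE a1D /and5P[a2D b1E b2E /andP[lt1 lt2] lt3].
    have EP : E \in P.
      case/setU1P: EQ => // eE; move: minE; rewrite eE => /is_min_unique /(_ minx) e.
      by rewrite e eqxx in b1x.
    (* Were the new block first, [x] would precede [b1], a minimum of a block of [P], against
       [mins_below P x]. *)
    have DP : D \in P.
      case/setU1P: DQ => // eD; move: minD; rewrite eD => /is_min_unique /(_ minx) e.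
      have := mins_below_min mbP EP minE; rewrite e in lt1.
      by rewrite ltnNge ltnW.
    exists D; apply/existsP; exists E; apply/and3P; split=> //.
    by apply/and5P; split=> //; apply/and5P; split=> //; apply/andP.
  case/and5P: (DE) => DP EP neDE a1D /and5P[a2D b1E b2E /andP[lt1 lt2] lt3].
  split; first by apply: contraTneq (xP _ EP) => <-; rewrite negbK.
  apply/existsP; exists D; apply/existsP; exists E; apply/and3P; split=> //.
  apply/and5P; split=> //; rewrite ?in_setU1 ?DP ?EP ?orbT //.
  by apply/and5P; split=> //; apply/andP.
have newP y : y \in [set z | left_reduced_crossing Q z] :&: [set z | z.1.1.2 == x] ->
   exists D, [/\ D \in P, is_min y.1.1.1 D, y.1.2 \in D, y.1.1.2 = x & y.2 \in B /\ (x < y.1.2 < y.2)%N].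
  case: y => [[[a1 b1] a2] b2]; rewrite !inE /= => /andP[/existsP[D /existsP[E /and3P[DE minD minE]]] /eqP b1x].
  case/and5P: DE => DQ EQ neDE a1D /and5P[a2D b1E b2E /andP[lt1 lt2] lt3].
  have eE : E = x |: B.
    by case/setU1P: EQ => // /xP; rewrite -b1x b1E.
  have DP : D \in P by case/setU1P: DQ neDE => // ->; rewrite eE eqxx.
  exists D; rewrite -b1x lt2; split=> //; split=> //.
  by move: b2E; rewrite eE => /setU1P[e|//]; move: (ltn_trans lt2 lt3); rewrite b1x e ltnn.
(* A crossing with [b1 = x] is recovered from (a2, b2), since [a1] is the minimum of the block of
   [a2]. *)
rewrite -(card_in_imset (f := fun y : 'I_K * 'I_K * 'I_K * 'I_K => (y.1.2, y.2))); last first.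
  move=> y z /newP[D [DP minD yD yx _]] /newP[E [EP minE zE zx _]].
  case: y z minD yD yx minE zE zx => [[[a1 b1] a2] b2] [[[c1 d1] c2] d2] /=.
  move=> minD yD -> minE zE -> [e2 ->]; rewrite -e2 in zE *.
  by rewrite -(def_pblock tiP DP yD) in minD; rewrite -(def_pblock tiP EP zE) in minE;
     rewrite (is_min_unique minD minE).
apply: eq_card => -[a2 b2]; apply/imsetP/idP => [[y /newP[D [DP _ yD _ [yB /andP[lt1 lt2]]]] [-> ->]]|].
  rewrite !inE /= lt2 yB lt1 !andbT.
  have := subsetP (partitionS partP DP) _ yD; rewrite !inE negb_or.
  by case/andP => /andP[_ ->] ->.
rewrite !inE /= => /and3P[/andP[a2B /andP[a2S lt1]] b2B lt2].
have a2P : a2 \in cover P.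
  rewrite (cover_partition partP) !inE negb_or a2B a2S !andbT.
  by apply: contraTneq lt1 => ->; rewrite ltnn.
have a2D : a2 \in pblock P a2 by rewrite mem_pblock.
have DP := pblock_mem a2P.
have [a1 mina1] := exists_is_min a2D; exists (a1, x, a2, b2) => //.
rewrite !inE eqxx andbT; apply/existsP; exists (pblock P a2); apply/existsP; exists (x |: B).
rewrite mina1 minx !andbT; apply/and5P; split; rewrite ?in_setU1 ?DP ?eqxx ?orbT //.
- by apply: contraNneq (xP _ DP) => ->; rewrite setU11.
- by case/andP: mina1.
by rewrite a2D b2B orbT lt1 lt2 (mins_below_min mbP DP mina1).
Qed.

End Crossings.

(** * Sums of partition weights with bounded block minima *)

Section WeightedPartitions.
Variables (C : numFieldType) (q : C) (alpha : nat -> C).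

Definition partition_sum (K : nat) (S : {set 'I_K}) (j : nat) : C :=
  \sum_(P | partition P S && mins_below P j) partition_weight q alpha P.

Lemma partition_weightU1 (K : nat) (x : 'I_K) (S B : {set 'I_K}) P :
  x \in S -> B \subset [set i in S | (x < i)%N] ->
  partition P (S :\: (x |: B)) -> mins_below P x ->
  partition_weight q alpha ((x |: B) |: P)
  = q ^+ #|inversions B [set i in S | (x < i)%N]| * alpha #|B|.+1
    * partition_weight q alpha P.
Proof.
move=> xS BS partP mbP.
rewrite /partition_weight (restricted_crossing_numberU1 xS BS partP mbP).
have xB : x \notin B.
  by apply: contraTN BS => xB; apply/subsetPn; exists x => //; rewrite inE ltnn andbF.
rewrite big_setU1 /=; last first.
  apply/negP => /(partitionS partP)/subsetP/(_ x).
  by rewrite setU11 !inE eqxx => /(_ isT).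
by rewrite cardsU1 xB exprD [q ^+ _ * _]mulrC mulrACA.
Qed.

Lemma partition_sumS_notin (K : nat) (x : 'I_K) (S : {set 'I_K}) :
  x \notin S -> partition_sum S x.+1 = partition_sum S x.
Proof.
move=> xS; apply: eq_bigl => P; apply: andb_id2l => partP.
exact: mins_belowS xS.
Qed.

(** The new term collects the partitions in which [x] is a block minimum, hence the largest one; its
    block is [x |: B] with [B] after [x]. *)
Lemma partition_sumS (K : nat) (x : 'I_K) (S : {set 'I_K}) : x \in S ->
  partition_sum S x.+1 = partition_sum S x
  + \sum_(B : {set 'I_K} | B \subset [set i in S | (x < i)%N])
      q ^+ #|inversions B [set i in S | (x < i)%N]|
      * (alpha #|B|.+1 * partition_sum (S :\: (x |: B)) x).
Proof.
move=> xS; pose e (B : {set 'I_K}) := [exists i in B, (i < x)%N].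
pose G (B : {set 'I_K}) := \sum_(P | partition P (S :\: B) && mins_below P x)
   partition_weight q alpha (B |: P).
have mbU (B : {set 'I_K}) P j : mins_below (B |: P) j = [exists i in B, (i < j)%N] && mins_below P j.
  apply/forall_inP/andP => [h|[hB hP] D /setU1P[->//|/(forall_inP hP)//]].
  by split; [apply: h; rewrite setU11 | apply/forall_inP => D DP; apply: h; rewrite in_setU1 DP orbT].
have eqS : partition_sum S x.+1 = \sum_(B : {set 'I_K} | (B \subset S) && (x \in B)) G B.
  rewrite /partition_sum big_mkcondr (sum_partition_block _ xS).
  apply: eq_bigr => B /andP[_ xB]; rewrite /G [RHS]big_mkcondr; apply: eq_bigr => P partP.
  rewrite mbU (mins_belowS partP) ?inE ?xB //.
  suff -> : [exists i in B, (i < x.+1)%N] by [].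
  by apply/exists_inP; exists x.
have eqx : partition_sum S x = \sum_(B : {set 'I_K} | ((B \subset S) && (x \in B)) && e B) G B.
  rewrite /partition_sum big_mkcondr (sum_partition_block _ xS) [RHS]big_mkcondr.
  apply: eq_bigr => B /andP[_ xB]; rewrite /G -/(e B).
  under eq_bigr do rewrite mbU -/(e B).
  by case: (e B) => /=; [rewrite -big_mkcondr | rewrite big1].
rewrite eqS eqx (bigID e) /=; congr (_ + _).
pose Sx := [set i in S | (x <= i)%N].
have xSx : x \in Sx by rewrite inE xS leqnn.
have defSx : Sx :\ x = [set i in S | (x < i)%N].
  by apply/setP => i; rewrite !inE ltn_neqAle eq_sym andbCA.
transitivity (\sum_(B : {set 'I_K} | (B \subset Sx) && (x \in B)) G B).
  apply: eq_bigl => B; rewrite andbAC; congr (_ && _).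
  apply/andP/subsetP => [[BS /exists_inPn eB] i iB|h].
    by rewrite inE (subsetP BS) // leqNgt eB.
  split; first by apply/subsetP => i /h; rewrite inE => /andP[].
  by apply/exists_inPn => i /h; rewrite inE -leqNgt => /andP[].
rewrite sum_subset_mem // defSx; apply: eq_bigr => B BS.
rewrite /G /partition_sum !mulr_sumr; apply: eq_bigr => P /andP[partP mbP].
by rewrite (partition_weightU1 xS BS partP mbP) !mulrA.
Qed.

Lemma partition_sum0 (K : nat) (S : {set 'I_K}) : partition_sum S 0 = (#|S| == 0)%:R.
Proof.
have mb0 (P : {set {set 'I_K}}) : mins_below P 0 = (P == set0).
  apply/forall_inP/eqP => [h|-> B]; last by rewrite inE.
  by apply/setP => B; rewrite inE; apply/negP => /h /exists_inP[].
rewrite /partition_sum cards_eq0; have [->|S0] := eqVneq S set0.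
  rewrite (big_pred1 set0) => [|P]; last by rewrite partition_set0 mb0 andbb.
  rewrite /partition_weight big_set0 mulr1.
  suff -> : restricted_crossing_number (set0 : {set {set 'I_K}}) = 0%N by [].
  apply/eqP; rewrite cards_eq0; apply/eqP/setP => -[[[a1 b1] a2] b2]; rewrite !inE.
  by apply/negbTE/existsP => -[D /existsP[E /and3P[/and3P[]]]]; rewrite inE.
rewrite big1 // => P; rewrite mb0 => /andP[partP /eqP P0].
by move: S0; rewrite -(cover_partition partP) P0 /cover big_set0 eqxx.
Qed.

(** Both sides obey the same recursion in [j], summation over [B] by inversions giving the Gaussian
    binomial. [S] is arbitrary because the recursion removes blocks. *)
Lemma partition_sumE (K : nat) (S : {set 'I_K}) (j : nat) : (j <= K)%N ->
  partition_sum S j = partition_count q alpha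
     #|[set i in S | (i < j)%N]| #|[set i in S | (j <= i)%N]|.
Proof.
elim: j S => [|j IH] S le_jK.
  rewrite partition_sum0.
  have -> : [set i in S | (i < 0)%N] = set0 by apply/setP => i; rewrite !inE andbF.
  by rewrite cards0 /=; congr (_ == _)%:R; apply: eq_card => i; rewrite inE andbT.
pose x := Ordinal le_jK; have [xS|xS] := boolP (x \in S); last first.
  rewrite (@partition_sumS_notin K x) // IH ?(ltnW le_jK) //.
  have nj i : i \in S -> (i == j :> nat) = false.
    by move=> iS; apply: contraNF xS => /eqP e; have -> : x = i by apply: val_inj.
  by congr partition_count; apply: eq_card => i; rewrite !inE; apply: andb_id2l => iS; have := nj i iS; lia.
rewrite (@partition_sumS K x) // IH ?(ltnW le_jK) //.
have cu : #|[set i in S | (i < j.+1)%N]| = #|[set i in S | (i < j)%N]|.+1.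
  rewrite (cardsD1 x) inE xS ltnS leqnn add1n; congr _.+1; apply: eq_card => i.
  by rewrite !inE ltnS [(i <= j)%N]leq_eqVlt -(inj_eq val_inj) /=; case: ltngtP; rewrite ?andbF.
have cv : #|[set i in S | (j <= i)%N]| = #|[set i in S | (j < i)%N]|.+1.
  rewrite (cardsD1 x) inE xS leqnn add1n; congr _.+1; apply: eq_card => i.
  by rewrite !inE -(inj_eq val_inj) /=; case: ltngtP; rewrite ?andbF.
rewrite cu cv partition_countS; congr (_ + _).
set u := #|[set i in S | (i < j)%N]|; set T := [set i in S | (j < i)%N].
pose f b := alpha b.+1 * partition_count q alpha u (#|T| - b).
transitivity (\sum_(B : {set 'I_K} | B \subset T) q ^+ #|inversions B T| * f #|B|); last first.
  by rewrite sum_subset_inversions; apply: eq_bigr => b _; rewrite mulrA.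
apply: eq_bigr => B BT; rewrite IH ?(ltnW le_jK) //.
have inB i : i \in B -> (j < i)%N by move=> /(subsetP BT); rewrite inE => /andP[].
congr (_ * (_ * partition_count q alpha _ _)).
  apply: eq_card => i; rewrite !inE -(inj_eq val_inj) /=.
  have [/inB|iB] := boolP (i \in B); first by case: ltngtP; rewrite ?andbF.
  by case: ltngtP; rewrite ?andbF ?andbT.
rewrite -(setIidPr BT) -cardsD; apply: eq_card => i; rewrite !inE -(inj_eq val_inj) /= negb_or.
by do 2!case: (_ \in _); case: ltngtP.
Qed.

Lemma sum_partition_weight (K : nat) (S : {set 'I_K}) :
  \sum_(P | partition P S) partition_weight q alpha P = partition_count q alpha #|S| 0.
Proof.
(* At threshold [K] the condition on minima is void, blocks being nonempty. *)
have -> : \sum_(P | partition P S) partition_weight q alpha P = partition_sum S K.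
  apply: eq_bigl => P; apply/idP/andP => [partP|[] //]; split=> //.
  apply/forall_inP => B /(partition_neq0 partP)/set0Pn[i iB].
  by apply/exists_inP; exists i.
rewrite partition_sumE //; congr partition_count.
  by apply: eq_card => i; rewrite inE ltn_ord andbT.
by apply/eqP; rewrite cards_eq0; apply/eqP/setP => i; rewrite !inE leqNgt ltn_ord andbF.
Qed.
End WeightedPartitions.

(* At q = 1 the crossings do not matter and one can instead remove the block of
   a fixed point. *)
Lemma partition_count1S (C : numFieldType) (alpha : nat -> C) (k : nat) :
  partition_count 1 alpha k.+1 0
  = \sum_(b < k.+1) 'C(k, b)%:R * (alpha b.+1 * partition_count 1 alpha (k - b) 0).
Proof.
have := sum_partition_weight 1 alpha [set: 'I_k.+1]; rewrite cardsT card_ord => <-.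
rewrite (sum_partition_block _ (in_setT ord0)) sum_subset_mem ?in_setT //.
have cT : #|[set: 'I_k.+1] :\ ord0| = k.
  by apply/eqP; rewrite -eqSS -[X in _ == X]card_ord -cardsT (cardsD1 ord0) in_setT.
pose f b := alpha b.+1 * partition_count 1 alpha (k - b) 0.
(* The trivial factor at [q = 1] lets [sum_subset_inversions] count subsets by size. *)
transitivity (\sum_(B : {set 'I_k.+1} | B \subset setT :\ ord0)
    1 ^+ #|inversions B (setT :\ ord0)| * f #|B|); last first.
  by rewrite sum_subset_inversions cT; apply: eq_bigr => b _; rewrite qbinomial_bin.
apply: eq_bigr => B BT; rewrite expr1n mul1r.
have xB : ord0 \notin B by move: BT; rewrite subsetD1 => /andP[].
transitivity (\sum_(P | partition P ([set: 'I_k.+1] :\: (ord0 |: B)))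
    alpha #|B|.+1 * partition_weight 1 alpha P).
  apply: eq_bigr => P partP; rewrite /partition_weight !expr1n !mul1r big_setU1 /=.
    by rewrite cardsU1 xB.
  apply/negP => /(partitionS partP)/subsetP/(_ ord0).
  by rewrite setU11 !inE eqxx => /(_ isT).
rewrite -mulr_sumr sum_partition_weight; congr (_ * partition_count _ _ _ _).
rewrite cardsD setTI cardsT card_ord cardsU1 xB; lia.
Qed.

(** * Moments and cumulants supported on multiples of [m] *)

Section Cumulants.
Variables (C : numFieldType) (m : nat) (q : C) (mu : {scalar {poly C}}).
Hypothesis mu_supp : forall k, ~~ (m %| k)%N -> mu 'X^k = 0.

(** If [m] does not divide [k], every partition of [k] points has a block of size not divisible by
    [m]. Outside the one-block partition that block is smaller than [k], so induction applies. *)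
Lemma q_cumulant_support k : (0 < k)%N -> ~~ (m %| k)%N -> q_cumulant q mu k = 0.
Proof.
have [n] := ubnP k; elim: n k => // n IH k; rewrite ltnS => le_kn k_gt0 mk.
have /moment_cumulant_stepE/(_ k k_gt0) -> := moment_cumulant_q_cumulant q mu.
(* By induction [beta] agrees with the cumulants below [k], the only values the recursion at [k]
   reads. *)
pose beta j := if (m %| j)%N then q_cumulant q mu j else 0.
rewrite (@q_cumulant_step_local _ _ _ _ beta) => [|j /andP[j_gt0 lt_jk]]; last first.
  by rewrite /beta; case: ifPn => // mj; apply: IH => //; apply: leq_trans lt_jk _.
rewrite /q_cumulant_step mu_supp // big1 ?subr0 // => P /andP[partP _].
have [B BP mB] : exists2 B, B \in P & ~~ (m %| #|B|)%N.
  apply/exists_inP; apply: contraNT mk => /exists_inPn h.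
  rewrite -[k]card_ord -cardsT (card_partition partP); apply: (big_ind (fun j => m %| j)%N) => //.
  - by move=> *; apply: dvdn_add.
  - by move=> B /h; rewrite negbK.
by rewrite /partition_weight (bigD1 B) //= /beta (negPf mB) mul0r mulr0.
Qed.

Hypothesis q_prim : m.-primitive_root q.
Hypothesis mu1 : mu 'X^0 = 1.

Lemma moment_partition_count k :
  mu 'X^(m * k) = partition_count 1 (fun j => q_cumulant q mu (m * j)) k 0.
Proof.
rewrite -(partition_count_root _ _ q_prim q_cumulant_support) muln0.
have [->|] := posnP (m * k); first by rewrite mu1.
by move/(moment_cumulant_q_cumulant q mu) ->; rewrite sum_partition_weight cardsT card_ord.
Qed.

Lemma R_omega_log :
  R_omega m q mu
  =1 fps_log (fps_in_powers m (fun k => mu 'X^(k * m) / k`!%:R)).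
Proof.
have m_gt0 := prim_order_gt0 q_prim.
pose a j := q_cumulant q mu (m * j); pose M k := mu 'X^(m * k).
have MS k : M k.+1 = \sum_(b < k.+1) 'C(k, b)%:R * (a b.+1 * M (k - b)%N).
  rewrite /M moment_partition_count partition_count1S.
  by apply: eq_bigr => b _; rewrite moment_partition_count.
have fact_neq0 j : j`!%:R != 0 :> C by rewrite pnatr_eq0 -lt0n fact_gt0.
set f := fps_in_powers _ _.
have fE k : f (m * k)%N = M k / k`!%:R.
  by rewrite /f /fps_in_powers dvdn_mulr // mulKn // mulnC.
have RE k : R_omega m q mu (m * k.+1) = a k.+1 / k.+1`!%:R.
  by rewrite /R_omega /fps_in_powers dvdn_mulr // mulKn.
apply: fps_log_unique => [||N].
- by rewrite -(muln0 m) fE /M muln0 mu1 fact0 divr1.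
- by rewrite /R_omega /fps_in_powers dvdn0 div0n.
have [/dvdnP[[|k] EN]|mN] := boolP (m %| N.+1)%N; first by [].
  (* For N+1 = m(k+1) only the [i] with [m] dividing [i.+1] contribute, and the equation is [MS]
     times m / k!. *)
  rewrite mulnC in EN; rewrite EN (@sum_last_residue _ m k.+1 (fun i => i.+1%:R * R_omega m q mu i.+1 * f (N - i)%N)) //; last first.
    by move=> i mi; rewrite /R_omega /fps_in_powers (negPf mi) mulr0 mul0r.
  rewrite fE MS mulr_suml mulr_sumr; apply: eq_bigr => -[c /= lt_ck] _.
  have -> : (N - (m * c + m.-1) = m * (k - c))%N by rewrite mulnBr; lia.
  have -> : (m * c + m.-1).+1 = (m * c.+1)%N by rewrite mulnS; lia.
  rewrite fE RE !factS !natrM.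
  rewrite -(bin_fact (lt_ck : (c <= k)%N)) !natrM.
  have k0 j : j.+1%:R != 0 :> C by rewrite pnatr_eq0.
  have bin0 : 'C(k, c)%:R != 0 :> C by rewrite pnatr_eq0 -lt0n bin_gt0.
  move: (k0 k) (k0 c) bin0 (fact_neq0 c) (fact_neq0 (k - c)%N).
  move: k.+1%:R c.+1%:R 'C(k, c)%:R c`!%:R (k - c)`!%:R m%:R (a c.+1) (M _).
  by move=> *; field; rewrite -?mulf_neq0; apply/and5P.
rewrite /f {1}/fps_in_powers (negPf mN) mulr0 big1 // => -[i /= lt_iN] _.
have [mi|mi] := boolP (m %| i.+1)%N; last first.
  by rewrite /R_omega {1}/fps_in_powers (negPf mi) mulr0 mul0r.
(* [i.+1] and [N - i] add up to [N.+1], so they are not both multiples of [m]. *)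
have mNi : ~~ (m %| N - i)%N.
  by apply: contra mN => mNi; rewrite -(subnKC lt_iN) subSS dvdn_add.
by rewrite {1}/fps_in_powers (negPf mNi) mulr0.
Qed.
End Cumulants.

(** * Homogeneous elements of graded spaces *)

Lemma phi_exp_eq0 (C : numFieldType) (n : nat) (A : graded_ncps C n) (a : A) (w : C) k :
  a \in eigenspace_of A w -> w ^+ k != 1 -> ncps_phi A (a ^+ k) = 0.
Proof.
rewrite inE => /eqP aw wk.
(* Invariance under gamma gives phi(a^k) = w^k phi(a^k). *)
have : (1 - w ^+ k) * ncps_phi A (a ^+ k) = 0.
  rewrite mulrBl mul1r -{1}(ncps_phi_gamma (a ^+ k)) rmorphXn /= aw.
  by rewrite exprZn scalarZ subrr.
by move/eqP; rewrite mulf_eq0 subr_eq0 eq_sym (negPf wk) => /eqP.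
Qed.

Theorem theorem5p3 (R : realType) (n : nat) (A : graded_ncps R[i] n) (a : A)
    (q : R[i]) (ha : homogeneous a) (hq : n.-primitive_root q) :
  let n' := if a \in eigenspace_of A 1 then 1%N
            else (n %/ gcdn (q_degree q a) n)%N in
  graded_R q a =1
    fps_log (fps_in_powers n'
      (fun k : nat => moment_functional a 'X^(k * n') / k`!%:R)).
Proof.
have mu1 : moment_functional a 'X^0 = 1 by rewrite moment_functionalXn ncps_phi1.
rewrite /graded_R; case: ifP => _ /=.
  (* [R_one] is [R_omega] at [m = 1] and [omega = 1], and 1 is a primitive first root of unity. *)
  have one_prim : 1.-primitive_root (1 : R[i]) 
    by apply/andP; split=> //; apply/forallP => i; rewrite ord1 unity_rootE expr1 !eqxx.
  move=> N; rewrite -(R_omega_log _ one_prim mu1) => [|k]; last by rewrite dvd1n.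
  by rewrite /R_omega /fps_in_powers dvd1n divn1 mul1n.
(* With r the q-degree, [q ^+ r] has exact order n / gcd(r, n), so moments in degrees not divisible
   by it vanish. *)
apply: R_omega_log => // [k|]; last exact: exp_prim_root.
move=> mk; rewrite /= moment_functionalXn; apply: phi_exp_eq0 (q_degreeP hq ha) _.
by rewrite -(prim_order_dvd (exp_prim_root hq _)).
Qed.
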